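(* For any positive integer $n$, there is a bijection from $\Upsilon_{K_n,odd}$ to $A_{n+1}$, where $\Upsilon_{K_n,odd}$ is the set of odd $K_n$-partitionable permutations, $K_n$ is the complete graph with vertex set $[n]=\{1,\dots,n\}$, and $A_{n+1}$ is the set of alternating permutations on $[n+1]$.
   Context: Alternating permutations. A permutation $\sigma$ of $[n]$ is alternating if $\sigma(1)>\sigma(2)<\sigma(3)>\sigma(4)<\cdots\sigma(n)$. $A_n$ denotes the set of alternating permutations on $[n]$. Odd $H$-permutations. Let $H$ be a simple graph (possibly disconnected) on a finite totally ordered vertex set with $m$ elements, and let $\sigma=a_1a_2\cdots a_m$ be a permutation of $V(H)$ in one-line notation such that $a_1$ is the maximum vertex. For $2\le i\le m$ let $j=\max\{k : 1\le k<i,\ a_k>a_i\}$ and $\tilde N_{\sigma,i}=\{k : j\le k<i,\ a_ka_i\in E(H)\}$. Let $E_1=\emptyset$; for $i\ge2$ let $E_i=E_{i-1}$ if $\tilde N_{\sigma,i}=\emptyset$, and otherwise $E_i=E_{i-1}\cup\{a_{k_0}a_i\}$ with $k_0=\min\tilde N_{\sigma,i}$. Let $F_\sigma$ be the spanning forest of $H$ with edge set $E_m$. The permutation $\sigma$ is an odd $H$-permutation if $F_\sigma$ is a spanning tree of $H$ and $|\tilde N_{\sigma,i}|$ is odd for all $2\le i\le m$. Basic decomposition. For a permutation $\sigma=a_1\cdots a_n$ (one-line notation), let $a_{i_1}$ be the maximum of all the entries, and $\sigma_1=a_{i_1}a_{i_1+1}\cdots a_n$; let $a_{i_2}$ be the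 maximum of $\{a_1,\dots,a_{i_1-1}\}$ and $\sigma_2=a_{i_2}\cdots a_{i_1-1}$; and so on until all entries are used. The resulting factorization $\sigma=\sigma_t\sigma_{t-1}\cdots\sigma_1$ is the basic decomposition of $\sigma$. Odd $G$-partitionable permutations. Let $G$ be a simple connected graph with vertex set $[n]$. A permutation $\sigma$ of $[n]$ with basic decomposition $\sigma_t\cdots\sigma_1$ is an odd $G$-partitionable permutation if, for every $1\le i\le t$, $\sigma_i$ is an odd $G_i$-permutation, where $G_i$ is the subgraph of $G$ induced by the vertices appearing in $\sigma_i$ (with the inherited vertex order). The set of these is $\Upsilon_{G,odd}$. *)

(* Defs.v *)
From HB Require Import structures.
From mathcomp Require Import all_boot all_order all_fingroup.

Set Implicit Arguments.
Unset Strict Implicit.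
Unset Printing Implicit Defensive.

Import Order.TTheory.

Record sgraph (T : finType) := SGraph {
  verts : {set T};
  edges : {set {set T}};
  edgesP : [forall e in edges, (e \subset verts) && (#|e| == 2)]
}.

Section Graphs.
Variable T : finType.
Implicit Types (G F H : sgraph T) (S : {set T}).

Definition adj G : rel T := [rel x y | [set x; y] \in edges G].

Definition connected G : bool :=
  (verts G != set0) &&
  [forall x in verts G, forall y in verts G, connect (adj G) x y].

(* A cycle has no repeated vertex, so bounding its length by #|T| loses
   nothing and keeps the predicate boolean. *)
Definition acyclic G : bool :=
  [forall c : #|T|.-bseq T, (2 < size c) ==> ~~ ucycleb (adj G) c].

Definition tree G : bool := connected G && acyclic G.

Definition spanning_tree F H : bool :=
  [&& verts F == verts H, edges F \subset edges H & tree F].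

Lemma induced_edgesP G S :
  [forall e in [set e in edges G | e \subset S],
     (e \subset verts G :&: S) && (#|e| == 2)].
Proof.
apply/forall_inP => e; rewrite inE subsetI => /andP[eG eS].
by have /andP[-> ->] := forall_inP (edgesP G) e eG; rewrite eS.
Qed.

Definition induced G S : sgraph T := SGraph (induced_edgesP G S).

Lemma complete_edgesP :
  [forall e in [set e : {set T} | #|e| == 2],
     (e \subset [set: T]) && (#|e| == 2)].
Proof. by apply/forall_inP => e; rewrite inE subsetT. Qed.

Definition complete : sgraph T := SGraph complete_edgesP.

End Graphs.

Section OddPermutations.
Variables (d : Order.disp_t) (T : finOrderType d).
Implicit Types (G H : sgraph T) (s : seq T).

(* Words are indexed from 0: the letters of a word of length m are
   a 0, ..., a m.-1, usually written a_1, ..., a_m. *)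

Section Letters.
Variables (H : sgraph T) (a : nat -> T).

(* The set of indices k with a k > a i is nonempty whenever a 0 is the maximal
   letter and i > 0, so the default value 0 of \max is then irrelevant. *)
Definition last_larger (i : nat) : nat :=
  \max_(0 <= k < i | (a i < a k)%O) k.

(* The set of indices is given as an increasing list; its head is its minimum. *)
Definition Ntilde (i : nat) : seq nat :=
  [seq k <- index_iota (last_larger i) i | [set a k; a i] \in edges H].

Fixpoint forest_edges (i : nat) : {set {set T}} :=
  if i is i'.+1 then
    if Ntilde i is k0 :: _ then [set a k0; a i] |: forest_edges i'
    else forest_edges i'
  else set0.

Lemma forest_edges_sub i : forest_edges i \subset edges H.
Proof.
elim: i => [|i IHi]; first exact: sub0set.
rewrite [forest_edges _]/=; case def_N: (Ntilde i.+1) => [//|k0 N].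
rewrite subUset IHi andbT sub1set.
have: k0 \in Ntilde i.+1 by rewrite def_N mem_head.
by rewrite mem_filter => /andP[].
Qed.

Lemma forestP i :
  [forall e in forest_edges i, (e \subset verts H) && (#|e| == 2)].
Proof.
apply/forall_inP => e /(subsetP (forest_edges_sub i)).
exact: (forall_inP (edgesP H)).
Qed.

(* For a word of length m, the forest F_sigma is [forest m.-1]. *)
Definition forest (i : nat) : sgraph T := SGraph (forestP i).

End Letters.

Definition odd_graph_perm H s : bool :=
  if s is x :: _ then
    let a := nth x s in
    [&& perm_eq s (enum (verts H)),
        [forall y in verts H, (y <= x)%O],
        spanning_tree (forest H a (size s).-1) H
      & all (fun i => odd (size (Ntilde H a i))) (index_iota 1 (size s))]
  else false.

Definition max_pos s : nat := find (fun x => all (fun y => (y <= x)%O) s) s.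

(* The blocks are listed from right to left: sigma_1, sigma_2, ..., sigma_t.
   The argument [fuel] only serves termination; [size s] is enough since each
   step removes at least one letter. *)
Fixpoint basic_decomposition_rec (fuel : nat) s : seq (seq T) :=
  if fuel is fuel'.+1 then
    if s is [::] then [::]
    else drop (max_pos s) s :: basic_decomposition_rec fuel' (take (max_pos s) s)
  else [::].

Definition basic_decomposition s : seq (seq T) :=
  basic_decomposition_rec (size s) s.

Definition odd_partitionable_word G s : bool :=
  all (fun b => odd_graph_perm (induced G [set x in b]) b)
      (basic_decomposition s).

End OddPermutations.

Definition one_line (n : nat) (sigma : 'S_n) : seq 'I_n :=
  [seq sigma i | i <- enum 'I_n].

(* Here and below 'I_n = {0, ..., n-1} stands for [n] = {1, ..., n}. *)
Definition odd_partitionable (n : nat) (G : sgraph 'I_n) : {set 'S_n} :=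
  [set sigma : 'S_n | odd_partitionable_word G (one_line sigma)].

(* The index shift turns odd positions into even ones, so the descents of an
   alternating permutation are at the even indices. *)
Definition alternating (n : nat) : {set 'S_n} :=
  [set sigma : 'S_n | [forall i : 'I_n, forall j : 'I_n,
     (j == i.+1 :> nat) ==>
       (if odd i then sigma i < sigma j else sigma j < sigma i)]].

(* Main.v *)
(** Both sets are counted by the zigzag numbers E, via
      E(k+1) = [k = 0] + sum_(i odd) C(k, i) E(i) E(k - i).
    Cutting an alternating word at its minimum gives this recurrence for
    down-up words, and cutting at the maximum gives it for up-down words, so
    both are counted by E; cutting a down-up word at its maximum then gives
    the same sum over even i. Adding the two, 2 E(k+1) is the sum over all i
    for k > 0, and Pascal's rule yields
      E(k+2) = sum_i C(k, i) E(i+1) E(k - i).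
    In a complete graph F_sigma is always a spanning tree, so a block M v is
    odd iff every later letter is at odd distance from the last larger letter
    before it. Cutting v at its maximum gives the even recurrence, so there
    are E(|v|) such blocks; cutting a partitionable word at its maximum gives
    the last recurrence, so there are E(n+1) of them. *)

Require Import Defs.
From HB Require Import structures.
From mathcomp Require Import all_boot all_order all_fingroup.

Set Implicit Arguments.
Unset Strict Implicit.
Unset Printing Implicit Defensive.

Import Order.TTheory.

(** * Zigzag numbers *)

(** The recurrence uses all earlier values, so the whole table is built, which makes the recursion
    structural. The values begin 1, 1, 1, 2, 5, 16. *)
Fixpoint zigzags (n : nat) : seq nat :=
  if n is m.+1 then
    let e := nth 0 (zigzags m) in
    rcons (zigzags m)
      (if m is k.+1 then
         (k == 0) + \sum_(i < k.+1 | odd i) 'C(k, i) * (e i * e (k - i))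
       else 1)
  else [::].

Definition zigzag n := nth 0 (zigzags n.+1) n.

Lemma size_zigzags n : size (zigzags n) = n.
Proof. by elim: n => //= n IHn; rewrite size_rcons IHn. Qed.

Lemma nth_zigzags n i : i < n -> nth 0 (zigzags n) i = zigzag i.
Proof.
elim: n => // n IHn; rewrite ltnS leq_eqVlt => /orP[/eqP-> //|lt_in].
by rewrite [zigzags _]/= nth_rcons size_zigzags lt_in IHn.
Qed.

Lemma zigzagS k : zigzag k.+1 =
  (k == 0) + \sum_(i < k.+1 | odd i) 'C(k, i) * (zigzag i * zigzag (k - i)).
Proof.
rewrite {1}/zigzag [zigzags _]/= -/(zigzags k.+1).
rewrite nth_rcons size_zigzags ltnn eqxx; congr (_ + _).
by apply: eq_bigr => i _; rewrite !nth_zigzags // ltnS leq_subr.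
Qed.

Lemma zigzag1 : zigzag 1 = 1.
Proof. by rewrite zigzagS big_mkcond big_ord1. Qed.

(** * Words on a finite set, cut at a letter *)

Section Words.
Variable T : finType.
Implicit Types (S U : {set T}) (w u v : seq T) (P : pred (seq T)).

Definition words S : seq (seq T) := permutations (enum S).

Lemma mem_words S w : (w \in words S) = uniq w && ([set x in w] == S).
Proof.
rewrite mem_permutations; apply/idP/andP => [ew|[uw /eqP <-]].
  rewrite (perm_uniq ew) enum_uniq; split=> //.
  by apply/eqP/setP => x; rewrite inE (perm_mem ew) mem_enum.
by apply: uniq_perm; rewrite ?enum_uniq // => x; rewrite mem_enum inE.
Qed.

Lemma wordsP S w : reflect (uniq w /\ w =i S) (w \in words S).
Proof.
rewrite mem_words; apply: (iffP andP) => [[-> /eqP <-]|[-> eS]]; split=> //.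
  by move=> x; rewrite inE.
by apply/eqP/setP => x; rewrite inE eS.
Qed.

Lemma size_word S w : w \in words S -> size w = #|S|.
Proof. by rewrite mem_permutations cardE => /perm_size. Qed.

Lemma words0 : words set0 = [:: [::]].
Proof. by rewrite /words enum_set0. Qed.

Lemma cat_cons_inj (m : T) u v u' v' : m \notin u -> m \notin u' ->
  u ++ m :: v = u' ++ m :: v' -> u = u' /\ v = v'.
Proof.
elim: u u' => [|x u IHu] [|x' u'] //=.
- by move=> _ _ [].
- by rewrite inE => _ /norP[/eqP ne _] [/ne].
- by rewrite inE => /norP[/eqP ne _] _ [/esym/ne].
rewrite !inE => /norP[_ mu] /norP[_ mu'] [-> /(IHu _ mu mu')[-> ->]].
by [].
Qed.


(** A word has exactly one occurrence of [m], so it is cut there in a unique way; [U] is the set of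
    letters before [m], and it can be read off from the prefix. *)
Lemma words_split S (m : T) : m \in S ->
  perm_eq (words S)
    [seq p.1 ++ m :: p.2 | U <- enum (powerset (S :\ m)),
       p <- [seq (u, v) | u <- words U, v <- words (S :\ m :\: U)]].
Proof.
move=> mS; have nm U u : U \in powerset (S :\ m) -> u \in words U -> m \notin u.
  rewrite inE => sU /wordsP[_ ->]; apply/negP => /(subsetP sU).
  by rewrite !inE eqxx.
apply: uniq_perm; first exact: permutations_uniq.
  apply: allpairs_uniq_dep => [|U _|]; first exact: enum_uniq.
    by apply: allpairs_uniq => [||[? ?] [? ?] _ _ //]; apply: permutations_uniq.
  move=> _ _ /allpairsPdep[U [p [UP pw ->]]] /allpairsPdep[V [q [VP qw ->]]] /=.
  rewrite mem_enum in UP; rewrite mem_enum in VP.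
  case/allpairsP: pw => -[u v] /= [uw _ ->]; case/allpairsP: qw => -[u' v'] /=.
  move=> [uw' _ ->] /= /(cat_cons_inj (nm _ _ UP uw) (nm _ _ VP uw'))[eu ->].
  suff -> : U = V by rewrite eu.
  have [_ uU] := wordsP _ _ uw; have [_ uV] := wordsP _ _ uw'.
  by apply/setP => x; rewrite -uU -uV eu.
move=> w; apply/idP/allpairsPdep => [/wordsP[uw ew]|].
  have: m \in w by rewrite ew.
  move=> mw; case/splitPr: mw uw ew => u v uw ew.
  move: uw; rewrite cat_uniq /= negb_or -!andbA => /and5P[uu mu uv mv Uv].
  have memuv x : x \in S = [|| x \in u, x == m | x \in v].
    by rewrite -ew mem_cat inE.
  have xm x : x \in u -> x != m by apply: contraTneq => ->.
  have xm' x : x \in v -> x != m by apply: contraTneq => ->.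
  exists [set x in u], (u, v); split=> //.
    rewrite mem_enum inE; apply/subsetP => x; rewrite !inE => xu.
    by rewrite memuv xu xm.
  apply/allpairsP; exists (u, v); split=> //=; apply/wordsP; split=> // x.
    by rewrite !inE.
  rewrite !inE memuv; case: (boolP (x \in v)) => [xv|xv].
    by rewrite !orbT xm' // (hasPn uv x xv).
  by case: (x \in u); case: (x == m).
case=> U [p [UP /allpairsP[[u v] /= [/wordsP[uu eu] /wordsP[uv ev] ->]] ->]] /=.
move: UP; rewrite mem_enum inE => sU.
have sx x : x \in U -> (x != m) && (x \in S).
  by move/(subsetP sU); rewrite !inE.
have mU : m \notin U by apply/negP => /sx; rewrite eqxx.
apply/wordsP; split=> [|x].
  rewrite cat_uniq uu cons_uniq uv ev !inE eqxx andbF !andbT.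
  apply/hasPn => x /[!inE] /orP xv; change (x \notin u); rewrite eu.
  by case: xv => [/eqP-> //|]; rewrite ev inE => /andP[].
rewrite mem_cat inE eu ev !inE.
have [->|xm] := eqVneq x m; first by rewrite mS orbT.
by case: (boolP (x \in U)) => [/sx/andP[]|].
Qed.

(** Once [U] is fixed, the prefix and the suffix vary independently, so the count over each [U] is a
    product. *)
Lemma count_words_split S (m : T) P (c : pred nat) A B : m \in S ->
    (forall U u v, U \subset S :\ m -> u \in words U ->
       v \in words (S :\ m :\: U) ->
       P (u ++ m :: v) = [&& c #|U|, A u & B v]) ->
  count P (words S) =
    \sum_(U : {set T} | (U \subset S :\ m) && c #|U|)
      count A (words U) * count B (words (S :\ m :\: U)).
Proof.
move=> mS PAB; rewrite (seq.permP (words_split mS)) -sum1_count big_mkcond.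
rewrite big_allpairs_dep /= big_enum [in RHS]big_mkcondr /=.
under eq_bigl do rewrite inE.
apply: eq_bigr => U sU; rewrite big_allpairs_dep /=.
rewrite -[count A _]sum1_count -[count B _]sum1_count big_distrl /=.
rewrite [in RHS]big_mkcond /= -[RHS]/(if _ then _ else _).
have [cU|cU] := boolP (c #|U|); last first.
  rewrite big_seq big1 // => u uU; rewrite big_seq big1 // => v vU.
  by rewrite (PAB U) // (negPf cU).
rewrite !big_seq; apply: eq_bigr => u uU; rewrite mul1n [in RHS]big_mkcond /=.
case: ifP => Au.
  by rewrite !big_seq; apply: eq_bigr => v vU; rewrite (PAB U) // cU Au.
by rewrite big_seq big1 // => v vU; rewrite (PAB U) // cU Au.
Qed.

Lemma sum_card_subsets S (c : pred nat) (g : nat -> nat) :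
  \sum_(U : {set T} | (U \subset S) && c #|U|) g #|U| =
    \sum_(i < #|S|.+1 | c i) 'C(#|S|, i) * g i.
Proof.
(* Subsets are grouped by size; [inord] is faithful on the subsets of [S], the only ones in the
   sum. *)
pose h (U : {set T}) : 'I_#|S|.+1 := inord #|U|.
have hE U : U \subset S -> h U = #|U| :> nat.
  by move=> sUS; rewrite inordK // ltnS subset_leq_card.
rewrite (partition_big h (fun i => c i)) /=; last first.
  by move=> U /andP[/hE ->].
apply: eq_bigr => i ci.
rewrite -cards_draws -sum_nat_const; apply: eq_big => [U|U /andP[/andP[sU _]]].
  rewrite !inE -val_eqE /=; case: (boolP (U \subset S)) => //= sU.
  by rewrite hE //; case: eqP => [->|]; rewrite ?ci ?andbF.
by move/eqP <-; rewrite hE.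
Qed.

(** The common form of the recurrences: each later count is obtained by choosing the cut letter [m],
    a condition [c] on the length of the prefix, and properties [A], [B] of the two pieces whose
    counts depend only on size. *)
Lemma count_words_rec S (m : T) P (c : pred nat) A B (a b : nat -> nat) :
    m \in S ->
    (forall U u v, U \subset S :\ m -> u \in words U ->
       v \in words (S :\ m :\: U) ->
       P (u ++ m :: v) = [&& c #|U|, A u & B v]) ->
    (forall U, U \subset S :\ m -> count A (words U) = a #|U|) ->
    (forall U, U \subset S :\ m -> count B (words U) = b #|U|) ->
  count P (words S) =
    \sum_(i < #|S| | c i) 'C(#|S|.-1, i) * (a i * b (#|S|.-1 - i)).
Proof.
move=> mS PAB HA HB; rewrite (count_words_split mS PAB).
have S1 : #|S :\ m| = #|S|.-1 by rewrite [in RHS](cardsD1 m) mS.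
have S2 : #|S| = #|S :\ m|.+1 by rewrite (cardsD1 m) mS.
rewrite S2 [_.+1.-1]/=.
rewrite -(sum_card_subsets (S :\ m) c (fun i => a i * b (#|S :\ m| - i))).
apply: eq_bigr => U /andP[sU _]; rewrite HA // HB ?subsetDl //.
by rewrite cardsD (setIidPr sU).
Qed.

End Words.

(** * Counting alternating words *)

Section Alternation.
Variable T : finType.
Implicit Types (r : rel T) (S U : {set T}) (s u v : seq T).

(** The relation is reversed at each step: [>] gives the down-up words and [<] the up-down words. *)
Fixpoint alternates r s : bool :=
  if s is x :: s' then
    (if s' is y :: _ then r x y else true) && alternates (fun a b => r b a) s'
  else true.

(** A top letter can only stand where the relation in force is [r] on its left and reversed on its
    right, which fixes the parity of its position; a one-letter word escapes this constraint in the
    first case. The two cases are proved together because removing the first letter exchanges [r]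
    and its reverse. *)
Lemma alternates_split r m u v :
    {in u ++ v, forall x, r x m && ~~ r m x} ->
  alternates r (u ++ m :: v) =
    [&& odd (size u) || nilp u && nilp v, alternates r u & alternates r v] /\
  alternates (fun a b => r b a) (u ++ m :: v) =
    [&& ~~ odd (size u), alternates (fun a b => r b a) u & alternates r v].
Proof.
elim: u => [|x u IHu] top /=.
  case: v top => [|y v] //= top.
  by have /andP[-> /negPf->] := top y (mem_head _ _).
have {IHu} [|-> ->] := IHu.
  by move=> y uy; apply: top; rewrite inE uy orbT.
have /andP[rx rx'] := top x (mem_head _ _).
case: u {top} => [|y u] /=; first by rewrite rx (negPf rx').
by rewrite !orbF !negbK /nilp /=; split; case: odd; rewrite ?andbF //= andbA.
Qed.

(* Holds for both [<] and [>], so that one lemma covers the two kinds of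
   alternating words. *)
Definition has_tops r := forall S, S != set0 ->
  exists2 m, m \in S & {in S :\ m, forall x, r x m && ~~ r m x}.


Lemma count_alternates r : has_tops r -> forall S,
  count (alternates r) (words S) = zigzag #|S|.
Proof.
move=> tops S; have [k] := ubnP #|S|; elim: k S => // k IHk S leSk.
have [->|S0] := eqVneq S set0; first by rewrite words0 cards0.
have [m mS topm] := tops S S0.
have S2 : #|S| = #|S :\ m|.+1 by rewrite (cardsD1 m) mS.
have IH U : U \subset S :\ m -> count (alternates r) (words U) = zigzag #|U|.
  by move=> sU; apply: IHk; rewrite (leq_ltn_trans (subset_leq_card sU)) -?S2.
(* A single letter is treated apart: it is the exception to the parity rule, and the source of the
   term [k == 0] in the recurrence. *)
have [S1|S1] := posnP #|S :\ m|.
  rewrite S2 S1; have eS : S = [set m].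
    by rewrite -(setD1K mS) (cards0_eq S1) setU0.
  by rewrite eS /words enum_set1 zigzag1.
rewrite (count_words_rec (m := m) (c := odd) (A := alternates r)
  (B := alternates r) (a := zigzag) (b := zigzag)) //.
  by rewrite S2 zigzagS /= eqn0Ngt S1.
move=> U u v sU uU vU.
have [_ mu] := wordsP _ _ uU; have [_ mv] := wordsP _ _ vU.
have [|-> _] := @alternates_split r m u v.
  move=> x; rewrite mem_cat mu mv => xUv; apply: topm.
  by case/orP: xUv => [/(subsetP sU)//|]; rewrite inE => /andP[].
congr andb; rewrite (size_word uU).
suff ->: nilp u && nilp v = false by rewrite orbF.
apply: contraTF S1 => /andP[]; rewrite /nilp (size_word uU) (size_word vU).
by rewrite !cards_eq0 => /eqP->; rewrite setD0 -eqn0Ngt cards_eq0.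
Qed.

End Alternation.

Lemma has_tops_lt d (T : finOrderType d) : has_tops (fun x y : T => (x < y)%O).
Proof.
move=> S /set0Pn[x0 x0S].
case: (Order.TotalTheory.arg_maxP id x0S) => m mS mmax.
exists m => // x; rewrite !inE => /andP[xm xS].
by rewrite -leNgt lt_neqAle xm /= andbb; apply: mmax.
Qed.

Lemma has_tops_gt d (T : finOrderType d) : has_tops (fun x y : T => (y < x)%O).
Proof.
move=> S /set0Pn[x0 x0S].
case: (Order.TotalTheory.arg_minP id x0S) => m mS mmin.
exists m => // x; rewrite !inE => /andP[xm xS].
by rewrite -leNgt lt_neqAle eq_sym xm /= andbb; apply: mmin.
Qed.

(** * Further recurrences for the zigzag numbers *)

(** Down-up words on [k.+1] letters are counted twice: by [count_alternates], where the top for [>]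
    is the minimum, and by cutting at the maximum, which sits at an even index, with a down-up
    prefix and an up-down suffix. *)
Lemma zigzagS_even k : zigzag k.+1 =
  \sum_(i < k.+1 | ~~ odd i) 'C(k, i) * (zigzag i * zigzag (k - i)).
Proof.
pose T : finOrderType _ := 'I_k.+1; pose S := [set: T].
have S1 : #|S| = k.+1 by rewrite cardsT card_ord.
have S0 : S != set0 by rewrite -card_gt0 S1.
have [m mS topm] := has_tops_lt S0.
pose lt := fun x y : T => (x < y)%O; pose gt := fun x y : T => (y < x)%O.
have <- : count (alternates gt) (words S) = zigzag k.+1.
  by rewrite count_alternates ?S1 //; apply: has_tops_gt.
rewrite (count_words_rec (m := m) (c := predC odd) (A := alternates gt)
  (B := alternates lt) (a := zigzag) (b := zigzag)) ?S1 //=.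
- move=> U u v sU uU vU.
  have [_ mu] := wordsP _ _ uU; have [_ mv] := wordsP _ _ vU.
  have [|_ ->] := @alternates_split _ lt m u v.
    move=> x; rewrite mem_cat mu mv => xUv; apply: topm.
    by case/orP: xUv => [/(subsetP sU)//|]; rewrite inE => /andP[].
  by rewrite (size_word uU).
- by move=> U _; rewrite count_alternates //; apply: has_tops_gt.
- by move=> U _; rewrite count_alternates //; apply: has_tops_lt.
Qed.

Lemma zigzag_double k : 0 < k -> (zigzag k.+1).*2 =
  \sum_(i < k.+1) 'C(k, i) * (zigzag i * zigzag (k - i)).
Proof.
move=> k0; rewrite -addnn {1}zigzagS zigzagS_even eqn0Ngt k0 add0n.
by rewrite [RHS](bigID (fun i : 'I__ => odd i)).
Qed.

Lemma zigzagSS k : zigzag k.+2 =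
  \sum_(i < k.+1) 'C(k, i) * (zigzag i.+1 * zigzag (k - i)).
Proof.
pose g i := 'C(k, i) * (zigzag i.+1 * zigzag (k - i)).
apply: double_inj; rewrite zigzag_double //.
(* Pascal's rule, after isolating the term [i = 0], which goes to the first sum. *)
have -> : \sum_(i < k.+2) 'C(k.+1, i) * (zigzag i * zigzag (k.+1 - i)) =
  \sum_(i < k.+2) 'C(k, i) * (zigzag i * zigzag (k.+1 - i)) +
  \sum_(i < k.+1) g i.
  rewrite [LHS]big_ord_recl [in RHS]big_ord_recl !bin0 -addnA; congr (_ + _).
  rewrite -big_split /=; apply: eq_bigr => i _.
  by rewrite /bump /= add1n subSS binS mulnDl.
rewrite big_ord_recr /= bin_small // mul0n addn0 -addnn; congr (_ + _).
(* The substitution of [k - i] for [i] and the symmetry of binomials turn the first sum into the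
   second. *)
rewrite (reindex_inj rev_ord_inj) /=; apply: eq_bigr => i _.
have le_ik : i <= k by rewrite -ltnS.
by rewrite subSS bin_sub // [zigzag (k - i) * _]mulnC subSn ?leq_subr // subKn.
Qed.

(** * Distance to the last larger letter *)

Section Gaps.
Variables (d : Order.disp_t) (T : finOrderType d).
Implicit Types (a b : nat -> T) (s u v : seq T) (S U : {set T}) (m M : T).

Lemma last_larger_eq a i j : j < i -> (a i < a j)%O ->
  (forall k, j < k < i -> ~~ (a i < a k)%O) -> last_larger a i = j.
Proof.
move=> lt_ji aij larger; apply/eqP; rewrite eqn_leq; apply/andP; split.
  apply/bigmax_leqP_seq => k; rewrite mem_index_iota => /= lt_ki aik.
  by rewrite leqNgt; apply: contraL aik => lt_jk; rewrite larger ?lt_jk.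
by apply: leq_bigmax_seq; rewrite ?mem_index_iota.
Qed.

Lemma last_largerP a i : 0 < i -> (a i < a 0)%O ->
  [/\ last_larger a i < i, (a i < a (last_larger a i))%O
    & forall k, last_larger a i < k < i -> ~~ (a i < a k)%O].
Proof.
move=> i0 ai0; pose P k := (k < i) && (a i < a k)%O.
have P0 : exists k, P k by exists 0; rewrite /P i0.
have Pi k : P k -> k <= i by case/andP => /ltnW.
case: (ex_maxnP P0 Pi) => j /andP[lt_ji aij] jmax.
suff larger k : j < k < i -> ~~ (a i < a k)%O.
  by rewrite (last_larger_eq lt_ji aij larger).
case/andP=> lt_jk lt_ki; apply: contraL lt_jk => aik.
by rewrite -leqNgt jmax // /P lt_ki.
Qed.

Lemma eq_last_larger a b i : (forall k, k <= i -> a k = b k) ->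
  last_larger a i = last_larger b i.
Proof.
move=> ab; rewrite /last_larger big_nat_cond [RHS]big_nat_cond.
apply: eq_bigl => k; case: (ltnP k i) => [lt_ki|_]; last by rewrite andbF.
by rewrite !ab // ltnW.
Qed.

(** Position [c] already holds a larger letter, so the last larger one is never to the left of
    [c]. *)
Lemma last_larger_shift a c i : 0 < i -> (a (c + i) < a c)%O ->
  last_larger a (c + i) = c + last_larger (fun k => a (c + k)) i.
Proof.
move=> i0 aci; set b := fun k => _.
have [|lt_ji bij larger] := @last_largerP b i i0; first by rewrite /b addn0.
apply: last_larger_eq => //; first by rewrite ltn_add2l.
move=> k /andP[lt_k lt_ki]; have le_ck : c <= k.
  by rewrite ltnW // (leq_ltn_trans _ lt_k) ?leq_addr.
rewrite -(subnKC le_ck); apply: larger.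
by rewrite -(ltn_add2l c) -[_ < i](ltn_add2l c) subnKC ?lt_k.
Qed.

(** This is the oddness condition for a complete graph, where [Ntilde] at [i] is the full interval
    from the last larger position up to [i - 1], of length equal to the gap. *)
Definition odd_gaps s : bool :=
  if s is x :: _ then
    all (fun i => odd (i - last_larger (nth x s) i)) (index_iota 1 (size s))
  else true.

(** Only [M] exceeds [m], so the gap of [m] is [(size u).+1]. The gaps in [u] depend only on
    [M :: u], while [m] acts as a barrier for the letters of [v], whose gaps are those in
    [m :: v]. *)
Lemma odd_gaps_split M m u v :
    (m < M)%O -> {in u ++ v, forall x, (x < m)%O} ->
  odd_gaps (M :: u ++ m :: v) =
    [&& ~~ odd (size u), odd_gaps (M :: u) & odd_gaps (m :: v)].
Proof.
move=> lt_mM lt_m; rewrite /odd_gaps /index_iota /= !subSS !subn0.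
set w := M :: u ++ m :: v; set c := (size u).+1.
have wc i : nth M w (c + i) = nth M (m :: v) i.
  by rewrite /w /c addSn /= nth_cat ltnNge leq_addr /= addKn.
rewrite size_cat /= iotaD all_cat /=.
rewrite add1n -/c.
have -> : last_larger (nth M w) c = 0.
  have wc0 : nth M w c = m by rewrite -[c]addn0 wc.
  apply: last_larger_eq => //; first by rewrite wc0.
  case=> // k /andP[_ lt_k]; rewrite wc0 /w /= nth_cat ifT //.
  by rewrite -leNgt ltW // lt_m // mem_cat mem_nth.
rewrite subn0 andbCA; congr [&& _, _ & _].
  apply: eq_in_all => i; rewrite mem_iota add1n => /andP[_ lt_i].
  congr (odd (i - _)); apply: eq_last_larger => k le_ki.
  rewrite /w -cat_cons nth_cat /= ifT //.
  exact: leq_ltn_trans le_ki lt_i.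
rewrite -[c.+1]addn1 iotaDl all_map; apply: eq_in_all => i.
rewrite mem_iota add1n => /andP[i0 lt_i] /=.
rewrite last_larger_shift // ?subnDl.
  congr (odd (i - _)); apply: eq_last_larger => k le_ki.
  rewrite wc; apply: set_nth_default; exact: leq_ltn_trans le_ki lt_i.
rewrite wc -[c]addn0 wc /=; case: i i0 lt_i => //= i _ lt_i.
by rewrite lt_m // mem_cat mem_nth ?orbT.
Qed.

(** Cutting at the maximum [m] of [S] gives the even recurrence. The induction lets the head [M]
    vary, since the suffix becomes a block headed by [m]. *)
Lemma count_odd_gaps S M : {in S, forall x, (x < M)%O} ->
  count (fun v => odd_gaps (M :: v)) (words S) = zigzag #|S|.
Proof.
have [k] := ubnP #|S|; elim: k S M => // k IHk S M leSk topM.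
have [->|S0] := eqVneq S set0; first by rewrite words0 cards0.
have [m mS topm] := has_tops_lt S0.
have ltm x : x \in S :\ m -> (x < m)%O by move/topm/andP => [].
have S2 : #|S| = #|S :\ m|.+1 by rewrite (cardsD1 m) mS.
have leUk U : U \subset S :\ m -> #|U| < k.
  by move=> sU; rewrite (leq_ltn_trans (subset_leq_card sU)) -?S2.
rewrite (count_words_rec (m := m) (c := predC odd)
  (A := fun u => odd_gaps (M :: u)) (B := fun v => odd_gaps (m :: v))
  (a := zigzag) (b := zigzag)) //.
- by rewrite S2 zigzagS_even.
- move=> U u v sU uU vU.
  have [_ mu] := wordsP _ _ uU; have [_ mv] := wordsP _ _ vU.
  rewrite odd_gaps_split ?topM ?(size_word uU) // => x.
  rewrite mem_cat mu mv => xUv; apply: ltm.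
  by case/orP: xUv => [/(subsetP sU)//|]; rewrite inE => /andP[].
- move=> U sU; apply: IHk => [|x xU]; first exact: leUk.
  by apply: topM; move/(subsetP sU): xU; rewrite inE => /andP[].
move=> U sU; apply: IHk => [|x xU]; first exact: leUk.
exact: ltm (subsetP sU x xU).
Qed.

End Gaps.

(** * Trees given by a parent function *)

Section ParentTrees.
Variable T : finType.

Lemma adj_sym (F : sgraph T) : symmetric (adj F).
Proof. by move=> x y; rewrite /adj /= setUC. Qed.

(** Passing to the parent lowers the position, so every vertex reaches the first one; each vertex
    has at most one neighbour before it, which excludes cycles. *)
Lemma parent_tree (F : sgraph T) (x0 : T) (s : seq T) (f : nat -> nat) :
    s != [::] -> uniq s -> verts F = [set x in s] ->
    (forall k, 0 < k < size s -> f k < k) ->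
    (forall e, e \in edges F <->
       exists2 k, 0 < k < size s & e = [set nth x0 s (f k); nth x0 s k]) ->
  tree F.
Proof.
move=> s0 us Vs f_lt Es; have size_s : 0 < size s by case: s s0 {us Vs f_lt Es}.
pose a := nth x0 s.
have symF : connect_sym (adj F) by apply: sym_connect_sym; apply: adj_sym.
have conn k : k < size s -> connect (adj F) (a 0) (a k).
  have [n] := ubnP k; elim: n k => // n IHn [|k] // le_kn lt_k.
  have lt_fk := f_lt k.+1 lt_k.
  apply: connect_trans (IHn (f k.+1) _ _) (connect1 _).
  - exact: leq_trans lt_fk le_kn.
  - exact: ltn_trans lt_fk lt_k.
  by apply/Es; exists k.+1.
apply/andP; split.
  apply/andP; split.
    by apply/set0Pn; exists (a 0); rewrite Vs inE mem_nth.
  apply/forall_inP => x; rewrite Vs inE => xs.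
  apply/forall_inP => y; rewrite inE => ys.
  rewrite -(nth_index x0 xs) -(nth_index x0 ys).
  apply: (connect_trans (y := a 0)); last by rewrite conn ?index_mem.
  by rewrite symF conn ?index_mem.
(* An edge comes from some index [k] and [f k < k], so its later endpoint is letter [k] and the
   other one its parent. *)
have parent x y : adj F x y -> index y s <= index x s -> y = a (f (index x s)).
  move=> /Es[k /[dup] kP /andP[_ lt_k]]; rewrite -/(a _) -/(a k) => exy.
  have lt_fk := f_lt k kP; have lt_fs := ltn_trans lt_fk lt_k.
  have xP : x \in [set a (f k); a k] by rewrite -exy set21.
  have yP : y \in [set a (f k); a k] by rewrite -exy set22.
  have fkP : a (f k) \in [set x; y] by rewrite exy set21.
  have kP' : a k \in [set x; y] by rewrite exy set22.
  have ne : a k != a (f k) by rewrite nth_uniq // eq_sym ltn_eqF.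
  move: xP yP fkP kP'; rewrite !inE.
  case/orP=> /eqP-> /orP[]/eqP->; rewrite ?orbb ?(negPf ne) //.
  - by rewrite /a !index_uniq // leqNgt lt_fk.
  - by rewrite /a !index_uniq.
  by rewrite [a (f k) == _]eq_sym (negPf ne).
apply/forallP => c; apply/implyP => size_c; apply/negP => /andP[cyc uc].
have [x1 c1] : exists x, x \in (c : seq T).
  by case: (c : seq T) size_c => // x l _; exists x; apply: mem_head.
(* Both neighbours on the cycle of its vertex of largest index are the parent
   of that vertex. *)
case: (arg_maxnP (fun x => index x s) c1) => z zc zmax.
have [i l def_l] := rot_to zc.
have mem_l x : x \in z :: l -> index x s <= index z s.
  by rewrite -def_l mem_rot; apply: zmax.
rewrite -(rot_cycle i) -(rot_uniq i) -(size_rot i) def_l in cyc uc size_c.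
case: l {def_l} mem_l cyc uc size_c => [|y l] // mem_l.
case/lastP: l mem_l => [|l t] // mem_l.
rewrite /= -rcons_cons rcons_path last_rcons.
case/and3P=> zy _ tz /and3P[_ yl _] _; case/negP: yl.
rewrite (parent z y) ?mem_l ?inE ?eqxx ?orbT //.
rewrite -(parent z t) ?mem_rcons ?inE ?eqxx // 1?adj_sym //.
by rewrite mem_l // !inE mem_rcons mem_head !orbT.
Qed.

End ParentTrees.

(** * Odd blocks and partitionable words in the complete graph *)

Section CompleteGraph.
Variables (d : Order.disp_t) (T : finOrderType d).
Implicit Types (S U : {set T}) (s u v : seq T) (m M : T).

Lemma edges_induced_complete S x y :
  ([set x; y] \in edges (induced (complete T) S)) =
    [&& x != y, x \in S & y \in S].
Proof. by rewrite !inE cards2 eqSS eqb1 subUset !sub1set. Qed.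

(** Every earlier letter is a neighbour, so each position after the first gets its last larger
    position as parent. The forest is then always a spanning tree, and only the parity of the gaps
    remains. *)
Lemma odd_graph_perm_complete M v :
    uniq (M :: v) -> {in v, forall x, (x < M)%O} ->
  odd_graph_perm (induced (complete T) [set x in M :: v]) (M :: v) =
    odd_gaps (M :: v).
Proof.
move=> uMv topM; set s := M :: v; set H := induced _ _; set a := nth M s.
have VH : verts H = [set x in s] by rewrite /= setTI.
have ll_lt k : 0 < k < size s -> last_larger a k < k.
  case/andP=> k0 lt_k; case: (@last_largerP _ _ a k k0) => //.
  by case: k k0 lt_k => //= k _ lt_k; rewrite /a /= topM ?mem_nth.
have NE k : 0 < k < size s -> Ntilde H a k = index_iota (last_larger a k) k.
  move=> /andP[k0 lt_k]; apply/all_filterP/allP => i.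
  rewrite mem_index_iota => /andP[_ lt_ik].
  have lt_i := ltn_trans lt_ik lt_k.
  by rewrite edges_induced_complete nth_uniq // (ltn_eqF lt_ik) !in_set !mem_nth.
have FE n e : n < size s -> e \in forest_edges H a n <->
    exists2 k, 0 < k < n.+1 & e = [set a (last_larger a k); a k].
  elim: n => [|n IHn] lt_n.
    by rewrite inE; split=> // -[[|k] /andP[]].
  have le_ll : last_larger a n.+1 <= n by rewrite -ltnS ll_lt.
  (* The interval is nonempty and begins at the last larger position, which is therefore [k0]. *)
  rewrite [forest_edges _ _ _]/= NE // /index_iota subSn //= in_setU1.
  have {}IHn := IHn (ltnW lt_n); split.
    case/predU1P => [->|/IHn[k /andP[k0 lt_k] ->]]; last first.
      by exists k; rewrite // k0 ltnW.
    by exists n.+1; rewrite ?ltnSn.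
  case=> k /andP[k0]; rewrite ltnS leq_eqVlt => /predU1P[-> ->|lt_k ek].
    by rewrite eqxx.
  by apply/orP; right; apply/IHn; exists k; rewrite ?k0.
have treeF : tree (forest H a (size s).-1).
  by apply: (@parent_tree _ _ M s (last_larger a)) => // e; apply: FE.
rewrite /odd_graph_perm /s -/s -/a.
have -> : perm_eq s (enum (verts H)).
  by apply: uniq_perm; rewrite ?enum_uniq // => x; rewrite mem_enum VH in_set.
have -> : [forall y in verts H, (y <= M)%O].
  apply/forall_inP => y; rewrite VH !inE => /orP[/eqP->//|/topM/ltW]; exact.
rewrite /spanning_tree treeF eqxx forest_edges_sub /=.
apply: eq_in_all => k; rewrite mem_index_iota => kP.
by rewrite NE // size_iota.
Qed.

Lemma basic_decomposition_rec_split n M u v : {in u ++ v, forall x, (x < M)%O} ->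
  basic_decomposition_rec n.+1 (u ++ M :: v) =
    (M :: v) :: basic_decomposition_rec n u.
Proof.
move=> topM; suff maxE : max_pos (u ++ M :: v) = size u.
  rewrite /= maxE drop_size_cat // take_size_cat //; by case: u {topM maxE}.
have le_M : all (fun y => (y <= M)%O) (u ++ M :: v).
  apply/allP => x; rewrite mem_cat inE orbCA => /predU1P[->//|].
  by rewrite -mem_cat => /topM/ltW.
rewrite /max_pos find_cat ifN.
  by rewrite /= le_M addn0.
apply/hasPn => x xu; apply/negP => /allP/(_ M).
by rewrite mem_cat mem_head orbT leNgt topM ?mem_cat ?xu // => /(_ isT).
Qed.

(** Induction on the fuel [n]. Cutting at the maximum [M] leaves a block [M :: v], counted by
    [count_odd_gaps], and a partitionable prefix of any length; hence [c] is [predT] and the sum is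
    that of [zigzagSS]. *)
Lemma count_odd_partitionable n S : #|S| <= n ->
  let odd_block b := odd_graph_perm (induced (complete T) [set x in b]) b in
  count (fun w => all odd_block (basic_decomposition_rec n w)) (words S) =
    zigzag #|S|.+1.
Proof.
move=> + odd_block.
elim: n S => [|n IHn] S leSn.
  have -> : S = set0 by apply/eqP; rewrite -cards_eq0 -leqn0.
  by rewrite words0 cards0 zigzag1.
have [->|S0] := eqVneq S set0; first by rewrite words0 cards0 zigzag1.
have [M MS topM] := has_tops_lt S0.
have S2 : #|S| = #|S :\ M|.+1 by rewrite (cardsD1 M) MS.
rewrite (count_words_rec (m := M) (c := predT)
  (A := fun u => all odd_block (basic_decomposition_rec n u))
  (B := fun v => odd_gaps (M :: v)) (a := fun k => zigzag k.+1)
  (b := zigzag)) //.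
- by rewrite S2 zigzagSS.
- move=> U u v sU uU vU.
  have [uu mu] := wordsP _ _ uU; have [uv mv] := wordsP _ _ vU.
  have lt_M : {in u ++ v, forall x, (x < M)%O}.
    move=> x; rewrite mem_cat mu mv => xUv; apply: (andP (topM x _)).1.
    by case/orP: xUv => [/(subsetP sU)//|]; rewrite inE => /andP[].
  have lt_Mv : {in v, forall x, (x < M)%O}.
    by move=> x xv; apply: lt_M; rewrite mem_cat xv orbT.
  rewrite basic_decomposition_rec_split // -cat1s all_cat all_seq1 andbC.
  rewrite /odd_block odd_graph_perm_complete // cons_uniq uv andbT.
  by apply/negP => /lt_Mv; rewrite ltxx.
- move=> U sU; apply: IHn; rewrite (leq_trans (subset_leq_card sU)) //.
  by rewrite -ltnS -S2.
by move=> U sU; apply: count_odd_gaps => x /(subsetP sU)/topM/andP[].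
Qed.

End CompleteGraph.

(** * From words to permutations, and the bijection *)

(** [one_line] maps permutations injectively to words, and there are n! of each, so every word is
    reached exactly once. *)
Lemma card_one_line n (P : pred (seq 'I_n)) :
  #|[set sigma : 'S_n | P (one_line sigma)]| = count P (words [set: 'I_n]).
Proof.
have one_line_inj : injective (@one_line n).
  move=> s t /eq_in_map st; apply/permP => i; apply: st; exact: mem_enum.
have word_one_line (s : 'S_n) : one_line s \in words [set: 'I_n].
  apply/wordsP; rewrite map_inj_uniq ?enum_uniq; last exact: perm_inj.
  split=> // i; rewrite inE; apply/mapP; exists (s^-1 i)%g; rewrite ?mem_enum //.
  by rewrite permKV.
have ew : perm_eq [seq one_line s | s <- enum [set: 'S_n]] (words [set: 'I_n]).
  have ul : uniq [seq one_line s | s <- enum [set: 'S_n]].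
    by rewrite map_inj_uniq ?enum_uniq.
  have [||_ ew] := @uniq_min_size _ _ (words [set: 'I_n]) ul.
  - by move=> _ /mapP[s _ ->].
  - rewrite size_permutations ?enum_uniq // size_map -!cardE !cardsT.
    by rewrite card_Sn card_ord.
  by apply: uniq_perm => //; apply: permutations_uniq.
rewrite -(seq.permP ew) count_map -sum1_count -sum1_card big_enum_cond.
by apply: eq_bigl => s; rewrite !inE.
Qed.

Lemma alternatesP (T : finType) (r : rel T) (x0 : T) (s : seq T) :
  reflect (forall i, i.+1 < size s ->
             if odd i then r (nth x0 s i.+1) (nth x0 s i)
             else r (nth x0 s i) (nth x0 s i.+1))
          (alternates r s).
Proof.
apply: (iffP idP).
  elim: s r => //= x s IHs r /andP[rx /IHs alt_s] [|i] /=.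
    by case: s rx {alt_s IHs}.
  by rewrite ltnS => /alt_s; case: odd.
elim: s r => //= x s IHs r alt_s; apply/andP; split.
  by case: s alt_s {IHs} => // y s /(_ 0); apply.
by apply: IHs => i lt_i; have:= alt_s i.+1 lt_i; rewrite /=; case: odd.
Qed.

Lemma alternating_one_line n (s : 'S_n) :
  (s \in alternating n) =
    alternates (fun x y : 'I_n => (y < x)%O) (one_line s).
Proof.
(* The empty case is separate because [ord0] and [inord] require a nonempty index type. *)
case: n s => [|n] s.
  rewrite inE /one_line; apply/forallP/idP => [_|_ []//].
  by case: (enum _) (size_enum_ord 0).
have nthE i : i < n.+1 -> nth ord0 (one_line s) i = s (inord i).
  move=> lt_i; rewrite (nth_map ord0) ?size_enum_ord //; congr (s _).
  by apply: val_inj; rewrite /= nth_enum_ord // inordK.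
have sz : size (one_line s) = n.+1 by rewrite size_map size_enum_ord.
rewrite inE; apply/forallP/(alternatesP _ ord0) => [alt_s i|alt_s i].
  rewrite sz => lt_i; have lt_i' := ltnW lt_i; rewrite !nthE //.
  have /forallP/(_ (inord i.+1)) := alt_s (inord i).
  by rewrite !inordK // eqxx.
apply/forallP => j; apply/implyP => /eqP ej.
have lt_i : i.+1 < n.+1 by rewrite -ej.
have := alt_s i; rewrite sz => /(_ lt_i); rewrite !nthE ?(ltnW lt_i) //.
by rewrite -ej !inord_val.
Qed.

Lemma card_alternating n : #|alternating n| = zigzag n.
Proof.
pose gt := fun x y : 'I_n => (y < x)%O.
have -> : alternating n = [set s | alternates gt (one_line s)].
  by apply/setP => s; rewrite alternating_one_line inE.
rewrite card_one_line count_alternates ?cardsT ?card_ord //.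
exact: has_tops_gt.
Qed.

Lemma card_odd_partitionable_complete n :
  #|odd_partitionable (complete 'I_n)| = zigzag n.+1.
Proof.
have cardT : #|[set: 'I_n]| = n by rewrite cardsT card_ord.
rewrite -[in RHS]cardT -(@count_odd_partitionable _ _ n) ?cardT //.
rewrite card_one_line; apply: eq_in_count => w /size_word; rewrite cardT => sz.
by rewrite /odd_partitionable_word /basic_decomposition sz.
Qed.

Theorem theorem1p4 (n : nat) (n_gt0 : 0 < n) :
  exists f : {sigma : 'S_n | sigma \in odd_partitionable (complete 'I_n)} ->
             {tau : 'S_n.+1 | tau \in alternating n.+1},
    bijective f.
Proof.
have eq_card :
    #|{: {sigma : 'S_n | sigma \in odd_partitionable (complete 'I_n)}}|
    = #|{: {tau : 'S_n.+1 | tau \in alternating n.+1}}|.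
  by rewrite !card_sig card_odd_partitionable_complete card_alternating.
(* Both types have [zigzag n.+1] elements, and elements of equal rank in their enumerations are
   matched. *)
exists (fun s => enum_val (cast_ord eq_card (enum_rank s))).
exists (fun t => enum_val (cast_ord (esym eq_card) (enum_rank t))) => x.
  by rewrite enum_valK cast_ordK enum_rankK.
by rewrite enum_valK cast_ordKV enum_rankK.
Qed.
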